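(* Let $(M,\mathcal C)$ be a differential space such that $(M,\tau_{\mathcal C})$ is Hausdorff. If there exists a finite or countable family of generators of $\mathcal C$, then the uniform space $(M,\mathcal U_{\mathcal C})$ is complete.
   Context: Differential spaces (Sikorski). For a nonempty set $M$ and a family $\mathcal C$ of functions $M\to\mathbb R$, $\tau_{\mathcal C}$ is the weakest topology on $M$ making all functions of $\mathcal C$ continuous. $\mathcal C$ is a differential structure on $M$ if: (a) every $f:M\to\mathbb R$ such that each $m\in M$ has a $\tau_{\mathcal C}$-neighbourhood $V$ and some $\alpha\in\mathcal C$ with $f|_V=\alpha|_V$ belongs to $\mathcal C$; and (b) $\omega\circ(\alpha_1,\dots,\alpha_n)\in\mathcal C$ for all $n\in\mathbb N$, $\omega\in C^\infty(\mathbb R^n)$, $\alpha_1,\dots,\alpha_n\in\mathcal C$. Then $(M,\mathcal C)$ is a differential space. A family $\mathcal F$ of real functions on $M$ is a family of generators of $\mathcal C$ if $\mathcal C$ is the smallest differential structure on $M$ containing $\mathcal F$. $\mathcal U_{\mathcal C}$ is the uniform structure on $M$ with base consisting of the sets $\{(x,y)\in M\times M: |f_i(x)-f_i(y)|<\varepsilon,\ i=1,\dots,k\}$, $k\in\mathbb N$, $f_1,\dots,f_k\in\mathcal C$, $\varepsilon>0$. A uniform space is complete if each Cauchy filter on it converges in the topology of the uniform structure. *)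

(* Defs.v *)
From HB Require Import structures.
From mathcomp Require Import all_boot all_order all_algebra.
From mathcomp Require Import finmap.
From mathcomp Require Import all_classical all_reals all_analysis.
Set Implicit Arguments.
Unset Strict Implicit.
Unset Printing Implicit Defensive.
Import Order.TTheory GRing.Theory Num.Theory.
Import numFieldTopology.Exports numFieldNormedType.Exports.

Local Open Scope classical_set_scope.
Local Open Scope ring_scope.

Fixpoint Ck (R : realType) (n k : nat) (f : 'rV[R]_n -> R) : Prop :=
  continuous f /\
  if k is k'.+1 then
    forall i : 'I_n, (forall x, derivable f x 'e_i) /\
                     Ck k' (fun x => 'D_('e_i) f x)
  else True.

Definition Coo (R : realType) (n : nat) (f : 'rV[R]_n -> R) : Prop :=
  forall k, Ck k f.

(* The underlying set M, tagged with C so that it can carry the topology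
   tau_C (generated by tau_subbase C) and the uniformity U_C as canonical
   structures; tau_nbhsE below shows that tau_C is the topology of U_C. *)
Definition dspace (R : realType) (M : Type) (C : set (M -> R)) : Type := M.

HB.instance Definition _ (R : realType) (M : pointedType) (C : set (M -> R)) :=
  Pointed.on (dspace C).

Definition tau_subbase (R : realType) (M : Type) (C : set (M -> R)) :
    set (set M) :=
  [set A | exists2 f, C f & exists2 U : set R, open U & A = f @^-1` U].

HB.instance Definition _ (R : realType) (M : pointedType) (C : set (M -> R)) :=
  @isSubBaseTopological.Build (dspace C) (set (dspace C)) (tau_subbase C) id.

Definition U_basic (R : realType) (M : Type) (k : nat) (f : 'I_k -> M -> R)
    (e : R) : set (M * M) :=
  [set xy | forall i, `|f i xy.1 - f i xy.2| < e].

Definition U_entourage (R : realType) (M : Type) (C : set (M -> R)) :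
    set_system (M * M) :=
  [set A | exists (k : nat) (f : 'I_k -> M -> R) (e : R),
     [/\ forall i, C (f i), 0 < e & U_basic f e `<=` A]].

Section dspace_uniform.
Local Open Scope relation_scope.
Context (R : realType) (M : pointedType) (C : set (M -> R)).

Let ent_filter : Filter (U_entourage C).
Proof.
split.
- by exists 0%N, (fun=> cst 0), 1; split=> //; case.
- move=> A B [k [f [e [Cf e0 fA]]]] [l [g [d [Cg d0 gB]]]].
  exists (k + l)%N,
    (fun i => match fintype.split i with inl j => f j | inr j => g j end),
    (Num.min e d); split.
  + by move=> i; case: (fintype.split i).
  + by rewrite lt_min e0.
  + move=> xy h; split; [apply: fA => i|apply: gB => i].
    * have := h (lshift l i).
      by rewrite (unsplitK (inl i)) lt_min => /andP[].
    * have := h (rshift k i).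
      by rewrite (unsplitK (inr i)) lt_min => /andP[].
- move=> A B AB [k [f [e [Cf e0 fA]]]].
  by exists k, f, e; split=> //; exact: subset_trans AB.
Qed.

Let ent_refl A : U_entourage C A -> diagonal `<=` A.
Proof.
move=> [k [f [e [_ e0 fA]]]] [x y] /diagonalP ->.
by apply: fA => i /=; rewrite subrr normr0.
Qed.

Let ent_inv A : U_entourage C A -> U_entourage C A^-1.
Proof.
move=> [k [f [e [Cf e0 fA]]]]; exists k, f, e; split=> // -[x y] h.
by apply: fA => i /=; rewrite distrC; exact: h.
Qed.

Let ent_split A : U_entourage C A -> exists2 B, U_entourage C B & B \; B `<=` A.
Proof.
move=> [k [f [e [Cf e0 fA]]]]; exists (U_basic f (e / 2)).
  by exists k, f, (e / 2); split=> //; rewrite divr_gt0.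
move=> [x y] [z /= xz zy]; apply: fA => i /=.
rewrite -(subrK (f i z) (f i x)) -addrA [e]splitr.
exact: le_lt_trans (ler_normD _ _) (ltrD (xz i) (zy i)).
Qed.

Let tau_nbhsE : @nbhs (dspace C) (dspace C) = nbhs_ (U_entourage C).
Proof.
rewrite predeq2E => x A; split.
- move=> [/= X [[/= B + <-] [W BW Wx BA]]] => /(_ W BW)[F Fsub Weq].
  have nbf : Filter (nbhs_ (U_entourage C) x).
    rewrite nbhs_E; apply: filter_from_filter; first by exists setT; exact: filterT.
    move=> E1 E2 h1 h2; exists (E1 `&` E2); last by rewrite xsectionI.
    exact: filterI.
  apply: (@filterS _ _ nbf W); first by move=> y Wy; apply: BA; exists W.
  rewrite -Weq; apply: filter_bigI => V FV.
  have Vx : V x by move: Wx; rewrite -Weq => /(_ V FV).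
  have := Fsub V FV; rewrite inE => -[f Cf [U oU VE]].
  move: Vx; rewrite VE /= => Ufx.
  have /nbhs_ballP[e /= e0 eU] : nbhs (f x) U by exact: open_nbhs_nbhs.
  rewrite nbhs_E; exists (U_basic (fun _ : 'I_1 => f) e).
    by exists 1%N, (fun=> f), e; split.
  by move=> y /xsectionP /(_ ord0) h; apply: eU.
- rewrite nbhs_E => -[E [k [f [e [Cf e0 fE]]]] EA].
  have: nbhs (x : dspace C) [set y | forall i, `|f i x - f i y| < e].
    apply: (@filter_forall _ _ (fun i y => `|f i x - f i y| < e) _
      (nbhs_filter (x : dspace C))) => i.
    pose V : set M := f i @^-1` ball (f i x) e.
    have oV : @open (dspace C) V.
      exists [set V]; last by rewrite bigcup_set1.
      move=> _ ->; exists [fset V]%fset; last first.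
        rewrite eqEsubset; split=> [y /(_ V)|y Vy j]; first by apply; rewrite /= inE.
        by rewrite /= inE => /eqP ->.
      move=> W /fset1P ->; rewrite inE.
      by exists (f i) => //; exists (ball (f i x) e) => //; exact: ball_open.
    by apply: (@open_nbhs_nbhs (dspace C)); split;
      [exact: oV|exact: (ballxx (f i x) e0)].
  by apply: filterS => y h; apply/EA/xsectionP/fE.
Qed.

HB.instance Definition _ := Nbhs_isUniform_mixin.Build (dspace C)
  ent_filter ent_refl ent_inv ent_split tau_nbhsE.

End dspace_uniform.

(* The convergence clause is the axiom of the library's completeType. *)
Definition uniform_complete (T : puniformType) : Prop :=
  forall F : set_system T, ProperFilter F -> cauchy F -> cvg F.

(* In the second clause n = 0 is allowed: it says that C contains the
   constants, i.e. that C is not the empty family. *)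
Definition diff_structure (R : realType) (M : pointedType)
    (C : set (M -> R)) : Prop :=
  (forall f : M -> R,
     (forall m : M, exists2 V : set M, nbhs (m : dspace C) V &
        exists2 a, C a & {in V, f =1 a}) -> C f) /\
  (forall (n : nat) (w : 'rV[R]_n -> R) (a : 'I_n -> M -> R),
     Coo w -> (forall i, C (a i)) -> C (fun m => w (\row_i a i m))).

Definition generates (R : realType) (M : pointedType) (F C : set (M -> R)) :
    Prop :=
  C = smallest (@diff_structure R M) F.

(* Main.v *)
Require Import Defs.
From HB Require Import structures.
From mathcomp Require Import all_boot all_order all_algebra.
From mathcomp Require Import ring lra.
From mathcomp Require Import all_classical all_reals all_analysis.
Import Order.TTheory GRing.Theory Num.Theory.
Import numFieldTopology.Exports numFieldNormedType.Exports.

Local Open Scope classical_set_scope.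
Local Open Scope ring_scope.

(* Let e_0, e_1, ... enumerate the generators. Along a Cauchy filter G every e_n
   converges, to p_n say. If some x satisfies e_n x = p_n for all n, then G
   converges to x, because the generators already induce tau_C. Otherwise a
   locally finite sum of smooth bumps in finitely many of the e_n gives a
   function of C that tends to infinity along G, which contradicts the Cauchy
   property. *)

(** * Flat smooth functions on the line *)

(* P(1/x) exp(-1/x), extended by 0 to x <= 0: a family of smooth functions that
   is closed under differentiation. *)
Definition flatexp {R : realType} (P : {poly R}) (x : R) : R :=
  if 0 < x then P.[x^-1] * expR (- x^-1) else 0.

(** The exponential series contributes its term of degree n+1, one more than the power to be beaten;
    the spare factor 1/t becomes, at t = 1/x, the linear bound of [flatexp_bound]. *)
Lemma exprn_expRN_le {R : realType} (n : nat) (t : R) : 0 < t ->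
  t ^+ n * expR (- t) <= n.+1`!%:R * t^-1.
Proof.
move=> t0; rewrite expRN ler_pdivrMr ?expR_gt0// mulrAC.
rewrite ler_pdivlMr// -exprSr.
have f0 : (0 : R) < n.+1`!%:R by rewrite ltr0n fact_gt0.
rewrite mulrC -ler_pdivrMr//.
by apply: le_trans (expR_ge1Dxn n (ltW t0)); rewrite lerDr.
Qed.

(** Holding for all [P] at once, the bound gives the limit 0 at 0, and with ['X * P] in place of [P]
    also the zero derivative there. *)
Lemma flatexp_bound {R : realType} (P : {poly R}) :
  exists2 B : R, 0 <= B & forall x, `|flatexp P x| <= B * `|x|.
Proof.
exists (\sum_(i < size P) `|P`_i| * i.+1`!%:R).
  by apply: sumr_ge0 => i _; rewrite mulr_ge0.
move=> x; rewrite /flatexp; case: ifPn => x0; last first.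
  by rewrite normr0 mulr_ge0// sumr_ge0// => i _; rewrite mulr_ge0.
rewrite (gtr0_norm x0) horner_coef !mulr_suml.
apply: le_trans (ler_norm_sum _ _ _) _; apply: ler_sum => i _.
rewrite -mulrA normrM -mulrA ler_wpM2l// ger0_norm; last first.
  by rewrite mulr_ge0 ?expR_ge0// exprn_ge0// invr_ge0 ltW.
have := exprn_expRN_le i x^-1; rewrite invr_gt0 invrK; exact.
Qed.

Lemma flatexp_cvg0 {R : realType} (P : {poly R}) : flatexp P x @[x --> 0] --> (0 : R).
Proof.
have [B B0 HB] := flatexp_bound P.
apply/norm_cvg0P; apply: (@squeeze_cvgr _ _ _ _ (cst 0) (fun x => B * `|x|)).
- by near=> x; rewrite normr_ge0 HB.
- exact: cvg_cst.
- rewrite -[X in _ --> X](mulr0 B); apply: cvgMl_tmp; rewrite -[X in _ --> X](normr0 R).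
  apply: cvg_norm; exact: cvg_id.
Unshelve. all: by end_near. Qed.

(** For x > 0 put t = 1/x: since dt/dx = -t^2, the derivative of P(t) exp(-t) is t^2 (P - P')(t)
    exp(-t). *)
Lemma is_derive_flatexp {R : realType} (P : {poly R}) (x : R) :
  is_derive x 1 (flatexp P) (flatexp ('X^2 * (P - P^`())) x).
Proof.
have [x0|x0|->] := ltgtP x 0.
- rewrite {2}/flatexp ltNge (ltW x0)/=.
  apply: (@near_eq_is_derive _ _ _ (cst 0)).
  near=> y; rewrite /flatexp ifN// -leNgt ltW//.
  by near: y; exact: lt_nbhsl.
- rewrite {2}/flatexp x0.
  apply: (@near_eq_is_derive _ _ _ ((horner P \o GRing.inv) *
    (expR \o (fun y => - y^-1)))).
    near=> y; rewrite /flatexp ifT//.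
    by near: y; exact: lt_nbhsr.
  have dV : is_derive x 1 (GRing.inv : R -> R) (- x ^- 2 *: 1).
    by apply: is_deriveV; rewrite gt_eqF.
  apply: is_derive_eq.
  rewrite hornerM hornerXn hornerD hornerN exprVn /GRing.scale/=.
  ring.
- suff h : h^-1 *: ((flatexp P \o shift (0:R)) (h *: 1) - flatexp P 0)
     @[h --> 0^'] --> (0 : R).
    rewrite [X in is_derive _ _ _ X]/flatexp ltxx.
    by split; [apply/cvg_ex; exists 0|apply: cvg_lim].
  (* Dividing by h multiplies the polynomial by its variable 1/h, so the difference quotient at 0 is
     again a [flatexp]. *)
  have -> : (fun h => h^-1 *: ((flatexp P \o shift (0:R)) (h *: 1) - flatexp P 0))
      = flatexp ('X * P).
    apply/funext => h; rewrite /flatexp ltxx subr0/= addr0 /GRing.scale/= mulr1.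
    by case: ifPn => _; rewrite ?mulr0// hornerM hornerX mulrA.
  apply: cvg_within_filter; exact: flatexp_cvg0.
Unshelve. all: by end_near. Qed.

Lemma flatexp_continuous {R : realType} (P : {poly R}) : continuous (flatexp P).
Proof.
move=> x; apply/differentiable_continuous/derivable1_diffP.
by have [] := is_derive_flatexp P x.
Qed.

(** * Functions of class C^k on R^n *)

Lemma Ck_continuous {R : realType} {n k : nat} {f : 'rV[R]_n -> R} :
  Ck k f -> continuous f.
Proof. by case: k => [|k] []. Qed.

Lemma Ck_pred {R : realType} {n k : nat} {f : 'rV[R]_n -> R} :
  Ck k.+1 f -> Ck k f.
Proof.
elim: k f => [|k IH] f [cf df]; first by split.
by split=> // i; have [dif kf] := df i; split=> //; exact: IH.
Qed.

Lemma Ck_cst {R : realType} {n : nat} (k : nat) (c : R) :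
  Ck k (cst c : 'rV[R]_n -> R).
Proof.
elim: k c => [|k IH] c; split=> //; try exact: cst_continuous.
move=> i; split; first by move=> x; exact: derivable_cst.
rewrite (_ : (fun x => _) = cst 0); first exact: IH.
by apply/funext => x; rewrite derive_cst.
Qed.

Lemma CkD {R : realType} {n k : nat} {f g : 'rV[R]_n -> R} :
  Ck k f -> Ck k g -> Ck k (f \+ g).
Proof.
elim: k f g => [|k IH] f g [cf df] [cg dg]; split=> //;
  try by move=> x; exact: continuousD (cf x) (cg x).
move=> i; have [dif kf] := df i; have [dig kg] := dg i.
split; first by move=> x; exact: derivableD.
rewrite (_ : (fun x => _) = (fun x => 'D_('e_i) f x) \+ (fun x => 'D_('e_i) g x)).
  exact: IH.
by apply/funext => x; rewrite deriveD.
Qed.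

Lemma CkM {R : realType} {n k : nat} {f g : 'rV[R]_n -> R} :
  Ck k f -> Ck k g -> Ck k (f \* g).
Proof.
elim: k f g => [|k IH] f g kf kg; have cf := Ck_continuous kf;
  have cg := Ck_continuous kg; split=> //;
  try by move=> x; exact: continuousM (cf x) (cg x).
move=> i; have [dif kdf] := kf.2 i; have [dig kdg] := kg.2 i.
split; first by move=> x; exact: derivableM.
rewrite (_ : (fun x => _) = (f \* (fun x => 'D_('e_i) g x)) \+
    (g \* (fun x => 'D_('e_i) f x))).
  (* The product rule keeps [f] and [g] themselves as factors, hence [Ck_pred]. *)
  by apply: CkD; apply: IH => //; exact: Ck_pred.
by apply/funext => x; rewrite deriveM.
Qed.

(** A move by h along ['e_i] shifts coordinate [j] by h if [i = j] and fixes it otherwise, so the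
    difference quotient is that of [phi] or zero. *)
Lemma is_derive_coord_comp {R : realType} {n : nat} {phi : R -> R} {d : R}
    (i : 'I_n) {j : 'I_n} {x : 'rV[R]_n} :
  is_derive (x 0 j) 1 phi d ->
  is_derive x 'e_i (fun y : 'rV[R]_n => phi (y 0 j)) ((i == j)%:R * d).
Proof.
have [->|ij] := eqVneq i j.
  rewrite mul1r.
  have E : (fun h => h^-1 *: (((fun y : 'rV[R]_n => phi (y 0 j)) \o shift x) (h *: 'e_j)
      - phi (x 0 j))) = (fun h => h^-1 *: ((phi \o shift (x 0 j)) (h *: 1) - phi (x 0 j))).
    by apply/funext => h /=; rewrite !mxE !eqxx.
  by move=> [dphi <-]; split; rewrite /derivable /derive E.
rewrite mul0r => _.
have E : (fun h => h^-1 *: (((fun y : 'rV[R]_n => phi (y 0 j)) \o shift x) (h *: 'e_i)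
      - phi (x 0 j))) = cst 0.
  apply/funext => h /=.
  by rewrite !mxE (negbTE (_ : j != i)) 1?eq_sym// andbF mulr0 add0r subrr scaler0.
split; rewrite /derivable /derive E; first exact: is_cvg_cst.
exact: lim_cst.
Qed.

Lemma Ck_coord {R : realType} {n : nat} (k : nat) (j : 'I_n) :
  Ck k (fun x : 'rV[R]_n => x 0 j).
Proof.
have dc (i : 'I_n) (x : 'rV[R]_n) := is_derive_coord_comp i (is_derive_id (x 0 j) 1).
case: k => [|k]; split=> //; try exact: coord_continuous.
move=> i; split; first by move=> x; have [] := dc i x.
rewrite (_ : (fun x => _) = cst ((i == j)%:R * 1 : R)); first exact: Ck_cst.
by apply/funext => x; have [] := dc i x.
Qed.

Lemma Ck_flatexp {R : realType} {n : nat} (k : nat) (P : {poly R}) (j : 'I_n) :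
  Ck k (fun x : 'rV[R]_n => flatexp P (x 0 j)).
Proof.
have cf (Q : {poly R}) : continuous (fun x : 'rV[R]_n => flatexp Q (x 0 j)).
  move=> x; apply: (@continuous_comp _ _ _ (fun x : 'rV[R]_n => x 0 j) (flatexp Q)).
    exact: coord_continuous.
  exact: flatexp_continuous.
(* [P] stays general because each derivative changes the polynomial. *)
elim: k P => [|k IH] P; split=> //.
have dc (i : 'I_n) (x : 'rV[R]_n) := is_derive_coord_comp i (is_derive_flatexp P (x 0 j)).
move=> i; split; first by move=> x; have [] := dc i x.
rewrite (_ : (fun x => _) = cst ((i == j)%:R : R) \*
  (fun x : 'rV[R]_n => flatexp ('X^2 * (P - P^`())) (x 0 j))).
  by apply: CkM => //; exact: Ck_cst.
by apply/funext => x; have [] := dc i x.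
Qed.

(** * Closure properties of a differential structure *)

Lemma diff_structure_cst {R : realType} {M : pointedType} {C : set (M -> R)}
    (dsC : diff_structure C) (c : R) : C (cst c).
Proof.
by apply: (dsC.2 0%N (cst c) (fun=> cst c)) => [k|[]//]; exact: Ck_cst.
Qed.

Lemma diff_structureD {R : realType} {M : pointedType} {C : set (M -> R)}
    (dsC : diff_structure C) (f g : M -> R) : C f -> C g -> C (f \+ g).
Proof.
move=> Cf Cg.
have := dsC.2 2%N (fun x => x 0 0 + x 0 1) (fun i => if i == 0 then f else g).
rewrite [X in _ -> _ -> C X](_ : _ = f \+ g); last first.
  by apply/funext => m; rewrite !mxE.
by apply=> [k|i]; [apply: CkD; exact: Ck_coord|case: ifP].
Qed.

Lemma diff_structureM {R : realType} {M : pointedType} {C : set (M -> R)}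
    (dsC : diff_structure C) (f g : M -> R) : C f -> C g -> C (f \* g).
Proof.
move=> Cf Cg.
have := dsC.2 2%N (fun x => x 0 0 * x 0 1) (fun i => if i == 0 then f else g).
rewrite [X in _ -> _ -> C X](_ : _ = f \* g); last first.
  by apply/funext => m; rewrite !mxE.
by apply=> [k|i]; [apply: CkM; exact: Ck_coord|case: ifP].
Qed.

Lemma diff_structure_flatexp {R : realType} {M : pointedType} {C : set (M -> R)}
    (dsC : diff_structure C) (P : {poly R}) (f : M -> R) :
  C f -> C (flatexp P \o f).
Proof.
move=> Cf; have := dsC.2 1%N (fun x => flatexp P (x 0 0)) (fun=> f).
rewrite [X in _ -> _ -> C X](_ : _ = flatexp P \o f); last first.
  by apply/funext => m; rewrite !mxE.
by apply=> [k|//]; exact: Ck_flatexp.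
Qed.

Lemma diff_structure_sum {R : realType} {M : pointedType} {C : set (M -> R)}
    (dsC : diff_structure C) (u : nat -> M -> R) (n : nat) :
  (forall i, C (u i)) -> C (fun m => \sum_(i < n) u i m).
Proof.
move=> Cu; elim: n => [|n IH].
  by under eq_fun do rewrite big_ord0; exact: diff_structure_cst.
by under eq_fun do rewrite big_ord_recr/=; exact: diff_structureD.
Qed.

(** * Convergence in tau_C *)

Lemma row_cvg {R : realType} {T : Type} {n : nat} (G : set_system T) (FG : Filter G)
    (a : 'I_n -> T -> R) (l : 'I_n -> R) :
  (forall i, a i t @[t --> G] --> l i) ->
  (\row_i a i t : 'rV[R]_n) @[t --> G] --> (\row_i l i : 'rV[R]_n).
Proof.
move=> al; apply/cvg_mx_entourageP => A entA.
apply: filter_forall => i; apply: filter_forall => j.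
have := al j _ (nbhs_entourage (l j) entA).
by apply: (@filterS _ G _) => t /= /xsectionP Alt; rewrite !mxE inE.
Qed.

(** A basic entourage constrains only finitely many functions, and a filter is closed under finite
    intersections. *)
Lemma cvg_dspace {R : realType} {M : pointedType} {C : set (M -> R)}
    (G : set_system M) (FG : Filter G) (x : M) :
  (forall f, C f -> f @ G --> f x) -> G --> (x : dspace C).
Proof.
move=> fG V; rewrite -nbhs_entourageE => -[E [k [f [e [Cf e0 fE]]]]] EV.
have : \forall y \near G, forall i, `|f i x - f i y| < e.
  apply: filter_forall => i; exact: cvgr_dist_lt (fG _ (Cf i)) _ e0.
by apply: filterS => y fxy; apply/EV/xsectionP/fE.
Qed.

Lemma U_entourage1 {R : realType} {M : Type} {C : set (M -> R)} (f : M -> R) (e : R) :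
  C f -> 0 < e -> U_entourage C (U_basic (fun _ : 'I_1 => f) e).
Proof. by move=> Cf e0; exists 1%N, (fun=> f), e; split. Qed.

Lemma continuous_dspace {R : realType} {M : pointedType} {C : set (M -> R)}
    (f : M -> R) : C f -> continuous (f : dspace C -> R).
Proof.
move=> Cf x; apply/(@cvgrPdist_lt _ _ _ _ (nbhs_filter (x : dspace C))) => e e0.
suff : nbhs (x : dspace C) [set y | `|f x - f y| < e] by [].
rewrite -nbhs_entourageE; exists (U_basic (fun _ : 'I_1 => f) e).
  exact: U_entourage1.
by move=> y /xsectionP /(_ ord0).
Qed.

(* The functions along which convergence on the generators propagates form a
   differential structure, so tau_C is the topology induced by the generators. *)
Lemma generates_cvg {R : realType} {M : pointedType} {F C : set (M -> R)}
    (G : set_system M) (FG : Filter G) (x : M) :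
  generates F C -> (forall f, F f -> f @ G --> f x) ->
  forall f, C f -> f @ G --> f x.
Proof.
pose D := [set f : M -> R | forall (G : set_system M) (x : M), Filter G ->
  (forall f, F f -> f @ G --> f x) -> f @ G --> f x].
move=> -> fG f; suff /[apply] : smallest (@diff_structure R M) F `<=` D by apply.
apply: smallest_sub => [|g Fg H y FH]; last exact.
split=> [g gloc H y FH Fy|n w a wC aD H y FH Fy].
  have [V Vy [b Db gb]] := gloc y.
  (* By definition of [D], every function of [D] converges along [H] to its value at [y]; so [H]
     converges to [y] in tau_D and contains [V]. *)
  have HV : H V by apply: (@cvg_dspace _ _ D _ _ y) Vy => h; exact.
  rewrite gb; last by rewrite inE; exact: (nbhs_singleton Vy).
  apply: cvg_trans (Db _ _ FH Fy); apply: near_eq_cvg.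
  by apply: filterS HV => z Vz; rewrite gb// inE.
apply: continuous_cvg; first exact: (Ck_continuous (wC 0%N)).
by apply: row_cvg => i; exact: aD.
Qed.

(** * Locally finite sums *)

Lemma diff_structure_glue {R : realType} {M : pointedType} {C : set (M -> R)}
    (u : nat -> M -> R) :
  diff_structure C -> (forall n, C (u n)) ->
  (forall m : dspace C, exists N, \forall y \near m,
     forall n, (N <= n)%N -> u n y = 0) ->
  exists2 g, C g & forall m K, (forall n, (K <= n)%N -> u n m = 0) ->
    g m = \sum_(i < K) u i m.
Proof.
move=> dsC Cu /choice[N uN].
(* The sum is independent of the cutoff, so the points near [m] may all use [N m] instead of their
   own. *)
have sumE m K K' : (forall n, (K <= n)%N -> u n m = 0) ->
    (forall n, (K' <= n)%N -> u n m = 0) ->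
    \sum_(i < K) u i m = \sum_(i < K') u i m.
  wlog KK' : K K' / (K <= K')%N.
    by move=> h uK uK'; have [/h|/ltnW/h] := leqP K K' => ->.
  move=> uK _; rewrite -(subnKC KK') big_split_ord/= [X in _ + X]big1 ?addr0//.
  by move=> i _; rewrite uK// leq_addr.
have gE m K : (forall n, (K <= n)%N -> u n m = 0) ->
    \sum_(i < N m) u i m = \sum_(i < K) u i m.
  by move=> uK; apply: sumE => //; exact: nbhs_singleton (uN m).
exists (fun m => \sum_(i < N m) u i m) => //.
(* On this neighbourhood the function agrees with one finite sum of members of [C], so locality
   applies. *)
apply: dsC.1 => m; exists [set y | forall n, (N m <= n)%N -> u n y = 0].
  exact: uN.
exists (fun y => \sum_(i < N m) u i y); first exact: (diff_structure_sum dsC).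
by move=> y; rewrite inE => /gE.
Qed.

(** * Cauchy filters of U_C *)

Lemma cauchy_dspace {R : realType} {M : pointedType} {C : set (M -> R)}
    {G : set_system (dspace C)} {f : M -> R} (e : R) :
  cauchy G -> C f -> 0 < e -> \forall x & y \near G, `|f x - f y| < e.
Proof.
move=> cG Cf e0.
have entU : @entourage (dspace C) (U_basic (fun _ : 'I_1 => f) e).
  exact: U_entourage1.
have [PQ GPQ PQU] := cG _ entU.
by exists PQ => // xy /PQU /(_ ord0).
Qed.

Lemma cauchy_dspace_cvg {R : realType} {M : pointedType} {C : set (M -> R)}
    {G : set_system (dspace C)} {f : M -> R} : ProperFilter G ->
  cauchy G -> C f -> cvg (f @ G).
Proof.
move=> PG cG Cf; apply/cauchy_cvgP/cauchy_ballP => e e0.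
have [[P Q] [GP GQ] PQe] := cauchy_dspace e cG Cf e0.
exists (f @` P, f @` Q) => /=.
  by split; [apply: filterS GP|apply: filterS GQ] => x ?; exists x.
by move=> [_ _] [/= [x Px <-] [y Qy <-]]; exact: (PQe (x, y)).
Qed.

Lemma countable_enum {R : realType} {M : pointedType} {F C : set (M -> R)} :
  diff_structure C -> countable F -> F `<=` C ->
  exists2 e : nat -> M -> R, (forall n, C (e n)) & F `<=` range e.
Proof.
(* A nonempty [F] is enumerated by a surjection from [nat], with repetitions if it is finite; for
   empty [F] any sequence in [C] serves. *)
move=> dsC /pfcard_geP[->|[e]] FC.
  by exists (fun=> cst 0) => // n; exact: diff_structure_cst.
exists e; last exact: surj.
by move=> n; apply: FC; exact: funS.
Qed.

(** * A function with a pole at a missing point *)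

(* The n-th summand is supported on the shrinking neighbourhood
   [sum_(i < n) (e_i - p_i)^2 < 1/(n+1)] of the missing point p and tends to 1
   at p; the sum is locally finite because p is not attained. *)
Lemma diff_structure_pole {R : realType} {M : pointedType} {C : set (M -> R)}
    (e : nat -> M -> R) (p : nat -> R) :
  diff_structure C -> (forall n, C (e n)) ->
  (forall x, ~ forall n, e n x = p n) ->
  exists2 g, C g & forall G : set_system M, Filter G ->
    (forall n, e n @ G --> p n) -> forall B, \forall y \near G, B < g y.
Proof.
move=> hC Ce nox.
pose q i := (e i \+ cst (- p i)) \* (e i \+ cst (- p i)).
have q0 i m : 0 <= q i m by rewrite /q /= -expr2 sqr_ge0.
have Cq i : C (q i).
  by apply: diff_structureM => //; apply: diff_structureD => //;
     exact: diff_structure_cst.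
pose h n : R := n.+1%:R^-1.
have h0 n : 0 < h n by rewrite invr_gt0 ltr0n.
(* [s n] is positive exactly on the n-th neighbourhood and tends to [h n] at p, so dividing by [c n]
   below normalises the limit of the bump to 1. *)
pose s n := cst (h n) \+ (cst (-1) \* (fun m => \sum_(i < n) q i m)).
pose c n := flatexp 1 (h n).
have c0 n : 0 < c n by rewrite /c /flatexp h0 hornerC mul1r expR_gt0.
pose u n := cst (c n)^-1 \* (flatexp 1 \o s n).
have u0 n m : 0 <= u n m.
  rewrite mulr_ge0 ?invr_ge0 ?(ltW (c0 n))// /flatexp /=.
  by case: ifP => // _; rewrite hornerC mul1r expR_ge0.
have Cu n : C (u n).
  apply: (diff_structureM hC); first exact: diff_structure_cst.
  apply: (diff_structure_flatexp hC); apply: (diff_structureD hC).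
    exact: diff_structure_cst.
  apply: (diff_structureM hC); first exact: diff_structure_cst.
  exact: (diff_structure_sum hC).
have uloc (m : dspace C) : exists N, \forall y \near m,
     forall n, (N <= n)%N -> u n y = 0.
  have /existsNP[j ejm] := nox m.
  have qm : 0 < q j m by rewrite lt_def q0 andbT /q/= -expr2 sqrf_eq0 subr_eq0; exact/eqP.
  have [K _ hK] := near_infty_natSinv_lt (PosNum (divr_gt0 qm (ltr0Sn R 1))).
  (* [j < n] puts [q j] among the summands of [s n], and [K <= n] gives [h n < q j m / 2]; where
     [q j] exceeds [q j m / 2], [s n] is then negative. *)
  exists (maxn j.+1 K).
  have := @cvgr_gt _ _ _ (nbhs_filter m) _ _ (continuous_dspace (q j) (Cq j) m) _
    (_ : q j m / 2 < q j m).
  rewrite ltr_pdivrMr// ltr_pMr// ltr1n => /(_ isT).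
  apply: (@filterS _ _ (nbhs_filter m)) => y qy n; rewrite geq_max => /andP[jn Kn].
  rewrite /u/= /flatexp ifN ?mulr0// -leNgt.
  have := hK _ Kn; rewrite /= -/(h n) => hn.
  have : q j y <= \sum_(i < n) q i y.
    by rewrite (bigD1 (Ordinal jn))//= lerDl sumr_ge0.
  rewrite /s/=; lra.
have [g Cg gE] := diff_structure_glue u hC Cu uloc.
(* All summands are nonnegative, so every partial sum bounds [g] from below. *)
have g_ge m K : \sum_(i < K) u i m <= g m.
  have [N /nbhs_singleton uN] := uloc m.
  rewrite (gE m (K + N)%N); last by move=> n Kn; rewrite uN// (leq_trans _ Kn)// leq_addl.
  by rewrite big_split_ord/= lerDl sumr_ge0.
exists g => // G FG ep B.
have sh n : s n @ G --> h n.
  rewrite -[X in _ --> X]addr0; apply: cvgD; first exact: cvg_cst.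
  rewrite -[X in _ --> X](mulr0 (-1)); apply: cvgM; first exact: cvg_cst.
  elim: n => [|n IH].
    rewrite (_ : (fun _ => _) = cst 0); first exact: cvg_cst.
    by apply/funext => m; rewrite big_ord0.
  rewrite (_ : (fun _ => _) = (fun m => \sum_(i < n) q i m) \+ q n); last first.
    by apply/funext => m; rewrite big_ord_recr.
  rewrite -[X in _ --> X]addr0; apply: cvgD => //.
  have ep0 : (e n \+ cst (- p n)) @ G --> (0 : R).
    by rewrite -(subrr (p n)); apply: cvgD; [exact: ep|exact: cvg_cst].
  by rewrite -(mulr0 (0 : R)); exact: cvgM.
have uG n : u n @ G --> (1 : R).
  rewrite -(mulVf (lt0r_neq0 (c0 n))); apply: cvgM; first exact: cvg_cst.
  by apply: continuous_cvg => //; exact: flatexp_continuous.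
(* Along [G] each of the first [K] bumps eventually exceeds 1/2, so [g] is at least K/2, which is
   greater than |B|. *)
pose K := Num.bound (2 * `|B|).
have : \forall y \near G, forall i : 'I_K, 2^-1 < u i y.
  by apply: filter_forall => i; apply: cvgr_gt (uG i) _ _; rewrite invf_lt1// ltr1n.
apply: filterS => y uy.
have gyK : K%:R * 2^-1 <= g y.
  apply: le_trans (g_ge y K); rewrite mulr_natl -[K in _ *+ K]card_ord -sumr_const.
  by apply: ler_sum => i _; exact/ltW/uy.
have : 2 * `|B| < K%:R by apply: archi_boundP; rewrite mulr_ge0.
have := ler_norm B; lra.
Qed.

(** * Completeness of U_C *)

Theorem theorem4p3 (R : realType) (M : pointedType) (C : set (M -> R))
  (hC : diff_structure C)
  (hausdorffC : hausdorff_space (dspace C))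
  (genC : exists2 F : set (M -> R), countable F & generates F C) :
  uniform_complete (dspace C).
Proof.
move=> G PG cG; have [F cF genF] := genC.
have FC : F `<=` C by rewrite genF; exact: sub_gen_smallest.
have [e Ce Fe] := countable_enum hC cF FC.
pose p n : R := lim (e n @ G).
have ep n : e n @ G --> p n by exact: cauchy_dspace_cvg cG (Ce n).
have [[x xp]|/forallNP nox] := pselect (exists x, forall n, e n x = p n).
  apply/cvg_ex; exists (x : dspace C); apply: cvg_dspace.
  apply: (generates_cvg G _ x genF) => f /Fe[n _ <-].
  by rewrite xp; exact: ep.
have [g Cg gG] := diff_structure_pole e p hC Ce nox.
(* With [x] fixed in [P], [g] stays below [g x + 1] on the whole of [Q], although it must exceed
   that value somewhere in [Q]. *)
have [[P Q] /= [GP GQ] PQ] := cauchy_dspace 1 cG Cg ltr01.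
have [x Px] := filter_ex GP.
have [y [Qy gy]] := filter_ex (filterI GQ (gG G _ ep (g x + 1))).
have := PQ (x, y) (conj Px Qy); rewrite /= distrC ltNge => /negP; case.
by rewrite (le_trans _ (ler_norm _))// lerBrDr addrC ltW.
Qed.
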